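(* The system $\textsf{M}$ proves the following. (i) Every binary sequence $\alpha^1$ (i.e. $\alpha(n)\le 1$ for all $n^0$) is standard. (ii) Every sequence of binary sequences (i.e. every $\beta^{0\to1}$ with $\beta(n,m)\le1$ for all $n^0,m^0$) is standard. (iii) Every sequence $\alpha^1$ which is standard for standard index, i.e. $(\forall^{\mathrm{st}}n^0)(\exists^{\mathrm{st}}m^0)(\alpha(n)=m)$, has a standard part, i.e. $(\exists^{\mathrm{st}}\beta^1)(\alpha\approx_1\beta)$.
   Context: Type $0$ is the type of natural numbers, $1$ is $0\to0$; superscripts denote types. $\textsf{E-PA}^{\omega}$ is classical Peano arithmetic in all finite types with the axiom of extensionality. Strong majorizability $\le^*$: $x\le^*_0y$ is $x\le_0y$, and $x\le^*_{\rho\to\sigma}y$ is $(\forall v)(\forall u\le^*_\rho v)(xu\le^*_\sigma yv\wedge yu\le^*_\sigma yv)$. An object $x$ is monotone if $x\le^*x$; $\tilde\forall,\tilde\exists$ denote quantifiers over monotone objects. The language of $\textsf{E-PA}^{\omega}_{\mathrm{st}}$ adds a predicate $\mathrm{st}^\sigma$ (``is standard'') for each finite type $\sigma$. A formula is internal if it does not involve $\mathrm{st}$. $(\forall^{\mathrm{st}}x)\Phi$ is $(\forall x)(\mathrm{st}(x)\to\Phi)$ and $(\exists^{\mathrm{st}}x)\Phi$ is $(\exists x)(\mathrm{st}(x)\wedge\Phi)$. $\textsf{E-PA}^{\omega}_{\mathrm{st}}$ is $\textsf{E-PA}^{\omega}$ plus: (1) $x=_\sigma y\to(\mathrm{st}(x)\to\mathrm{st}(y))$;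 (2) $\mathrm{st}(y)\to(x\le^*_\sigma y\to\mathrm{st}(x))$; (3) $\mathrm{st}(t)$ for each closed term $t$; (4) $\mathrm{st}(z^{\sigma\to\tau})\to(\mathrm{st}(x^\sigma)\to\mathrm{st}(zx))$; and external induction $\Phi(0)\wedge(\forall^{\mathrm{st}}n^0)(\Phi(n)\to\Phi(n+1))\to(\forall^{\mathrm{st}}n^0)\Phi(n)$ for any $\Phi$. $\textsf{M}$ is $\textsf{E-PA}^{\omega}_{\mathrm{st}}$ plus, for internal $\varphi$: monotone choice $\textsf{mAC}^\omega_{\mathrm{st}}$: $(\tilde\forall^{\mathrm{st}}x)(\tilde\exists^{\mathrm{st}}y)\varphi(x,y)\to(\tilde\exists^{\mathrm{st}}f)(\tilde\forall^{\mathrm{st}}x)(\exists y\le^*f(x))\varphi(x,y)$; realization $\textsf{R}^\omega$: $(\forall x)(\exists^{\mathrm{st}}y)\varphi(x,y)\to(\tilde\exists^{\mathrm{st}}z)(\forall x)(\exists y\le^*z)\varphi(x,y)$; and $\textsf{MAJ}^\omega_{\mathrm{st}}$: $(\forall^{\mathrm{st}}x)(\exists^{\mathrm{st}}y)(x\le^*y)$. $\alpha\approx_1\beta$ means $(\forall^{\mathrm{st}}n^0)(\alpha(n)=\beta(n))$. *)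

(* Defs.v *)
From Stdlib Require Import List.
Import ListNotations.

Set Implicit Arguments.
Unset Strict Implicit.
Unset Printing Implicit Defensive.

(** * Finite types, terms and formulas *)

Inductive ty : Type :=
| N : ty
| Arr : ty -> ty -> ty.

Declare Scope ty_scope.
Delimit Scope ty_scope with ty.
Bind Scope ty_scope with ty.
Infix "~>" := Arr (at level 55, right associativity) : ty_scope.
Open Scope ty_scope.

Definition ctx := list ty.

(** Well-typed de Bruijn indices: [VZ] is the most recently bound variable. *)
Inductive var : ctx -> ty -> Type :=
| VZ (G : ctx) (s : ty) : var (s :: G) s
| VS (G : ctx) (r s : ty) : var G s -> var (r :: G) s.

Arguments VZ {G s}.
Arguments VS {G r s} _.

(** [Pi], [Sg] are the combinators K and S of the lambda calculus. *)
Inductive term (G : ctx) : ty -> Type :=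
| Var (s : ty) : var G s -> term G s
| Zero : term G N
| Succ : term G (N ~> N)
| Pi (r s : ty) : term G (r ~> s ~> r)
| Sg (r s t : ty) : term G ((r ~> s ~> t) ~> (r ~> s) ~> r ~> t)
| Rec (r : ty) : term G (N ~> r ~> (r ~> N ~> r) ~> r)
| App (r s : ty) : term G (r ~> s) -> term G r -> term G s.

Arguments Var {G s} _.
Arguments Zero {G}.
Arguments Succ {G}.
Arguments Pi {G} r s.
Arguments Sg {G} r s t.
Arguments Rec {G} r.
Arguments App {G r s} _ _.

(** Only equality of natural numbers is primitive. *)
Inductive form (G : ctx) : Type :=
| Bot : form G
| Eq0 : term G N -> term G N -> form G
| St (s : ty) : term G s -> form G
| Imp : form G -> form G -> form G
| And : form G -> form G -> form G
| Or : form G -> form G -> form G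
| All (s : ty) : form (s :: G) -> form G
| Ex (s : ty) : form (s :: G) -> form G.

Arguments Bot {G}.
Arguments Eq0 {G} _ _.
Arguments St {G s} _.
Arguments Imp {G} _ _.
Arguments And {G} _ _.
Arguments Or {G} _ _.
Arguments All {G} s _.
Arguments Ex {G} s _.

Declare Scope obj_scope.
Delimit Scope obj_scope with obj.
Bind Scope obj_scope with term.
Bind Scope obj_scope with form.
Infix "$" := App (at level 20, left associativity) : obj_scope.
Infix "=:=" := Eq0 (at level 40, no associativity) : obj_scope.
Infix "/&\" := And (at level 51, right associativity) : obj_scope.
Infix "==>" := Imp (at level 55, right associativity) : obj_scope.
Open Scope obj_scope.

Definition Neg (G : ctx) (A : form G) : form G := A ==> Bot.

Fixpoint internal (G : ctx) (A : form G) : Prop :=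
  match A with
  | Bot => True
  | Eq0 _ _ => True
  | St _ => False
  | Imp A B => internal A /\ internal B
  | And A B => internal A /\ internal B
  | Or A B => internal A /\ internal B
  | All _ A => internal A
  | Ex _ A => internal A
  end.

(** ** Renaming and substitution *)

Definition ren (G D : ctx) : Type := forall s, var G s -> var D s.
Definition sub (G D : ctx) : Type := forall s, var G s -> term D s.

(** Case analysis on a variable of a nonempty context. *)
Definition var_case (G : ctx) (r : ty) (P : ty -> Type)
    (p0 : P r) (pS : forall s, var G s -> P s) (s : ty) (x : var (r :: G) s) :
    P s :=
  match x in var D s
    return match D with
           | [] => unit
           | r :: G => P r -> (forall s, var G s -> P s) -> P s
           end
  with
  | VZ => fun p0 _ => p0
  | VS y => fun _ pS => pS _ y
  end p0 pS.

Definition up_ren (r : ty) (G D : ctx) (f : ren G D) : ren (r :: G) (r :: D) :=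
  var_case (P := var (r :: D)) VZ (fun s x => VS (f s x)).

Fixpoint tren (G D : ctx) (f : ren G D) (s : ty) (t : term G s) : term D s :=
  match t with
  | Var x => Var (f _ x)
  | Zero => Zero
  | Succ => Succ
  | Pi r s => Pi r s
  | Sg r s t => Sg r s t
  | Rec r => Rec r
  | App t u => tren f t $ tren f u
  end.

Fixpoint fren (G D : ctx) (f : ren G D) (A : form G) : form D :=
  match A with
  | Bot => Bot
  | Eq0 t u => tren f t =:= tren f u
  | St t => St (tren f t)
  | Imp A B => fren f A ==> fren f B
  | And A B => fren f A /&\ fren f B
  | Or A B => Or (fren f A) (fren f B)
  | All s A => All s (fren (up_ren f) A)
  | Ex s A => Ex s (fren (up_ren f) A)
  end.

Definition shift (r : ty) (G : ctx) : ren G (r :: G) := fun s x => VS x.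
Definition twk (r : ty) (G : ctx) (s : ty) (t : term G s) : term (r :: G) s :=
  tren (@shift r G) t.
Definition fwk (r : ty) (G : ctx) (A : form G) : form (r :: G) :=
  fren (@shift r G) A.

Definition no_var (G : ctx) : ren [] G :=
  fun s x => match x in var D _ return match D with
                                       | [] => var G s
                                       | _ :: _ => unit
                                       end
             with VZ => tt | VS _ => tt end.

Definition scons (r : ty) (G D : ctx) (t : term D r) (f : sub G D) :
  sub (r :: G) D := var_case (P := term D) t f.

Definition up_sub (r : ty) (G D : ctx) (f : sub G D) : sub (r :: G) (r :: D) :=
  scons (Var VZ) (fun s x => twk r (f s x)).

Fixpoint tsub (G D : ctx) (f : sub G D) (s : ty) (t : term G s) : term D s :=
  match t with
  | Var x => f _ x
  | Zero => Zero
  | Succ => Succ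
  | Pi r s => Pi r s
  | Sg r s t => Sg r s t
  | Rec r => Rec r
  | App t u => tsub f t $ tsub f u
  end.

Fixpoint fsub (G D : ctx) (f : sub G D) (A : form G) : form D :=
  match A with
  | Bot => Bot
  | Eq0 t u => tsub f t =:= tsub f u
  | St t => St (tsub f t)
  | Imp A B => fsub f A ==> fsub f B
  | And A B => fsub f A /&\ fsub f B
  | Or A B => Or (fsub f A) (fsub f B)
  | All s A => All s (fsub (up_sub f) A)
  | Ex s A => Ex s (fsub (up_sub f) A)
  end.

(** [inst A t] is A(t), and [at_succ A] is A(n+1), where A = A(n) has the
    distinguished variable n = [VZ]. *)
Definition inst (r : ty) (G : ctx) (A : form (r :: G)) (t : term G r) : form G :=
  fsub (scons t (fun s x => Var x)) A.

Definition at_succ (G : ctx) (A : form (N :: G)) : form (N :: G) :=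
  fsub (scons (Succ $ Var VZ) (fun s x => Var (VS x))) A.

(** * Classical natural deduction over a set of axioms

    Axioms are given as open formulas; a derivation lives in a context [G] of
    free variables.  The logical rules apply to all formulas, also those
    involving [St]. *)

Definition theory : Type := forall G : ctx, form G -> Prop.

Inductive prov (T : theory) : forall G : ctx, list (form G) -> form G -> Prop :=
| p_ax G H (A : form G) : T G A -> prov T H A
| p_hyp G H (A : form G) : In A H -> prov T H A
| p_raa G H (A : form G) : prov T (Neg A :: H) Bot -> prov T H A
| p_impI G H (A B : form G) : prov T (A :: H) B -> prov T H (A ==> B)
| p_impE G H (A B : form G) : prov T H (A ==> B) -> prov T H A -> prov T H B
| p_andI G H (A B : form G) : prov T H A -> prov T H B -> prov T H (A /&\ B)
| p_andE1 G H (A B : form G) : prov T H (A /&\ B) -> prov T H A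
| p_andE2 G H (A B : form G) : prov T H (A /&\ B) -> prov T H B
| p_orI1 G H (A B : form G) : prov T H A -> prov T H (Or A B)
| p_orI2 G H (A B : form G) : prov T H B -> prov T H (Or A B)
| p_orE G H (A B C : form G) :
    prov T H (Or A B) -> prov T (A :: H) C -> prov T (B :: H) C -> prov T H C
| p_allI G H s (A : form (s :: G)) :
    prov T (map (@fwk s G) H) A -> prov T H (All s A)
| p_allE G H s (A : form (s :: G)) (t : term G s) :
    prov T H (All s A) -> prov T H (inst A t)
| p_exI G H s (A : form (s :: G)) (t : term G s) :
    prov T H (inst A t) -> prov T H (Ex s A)
| p_exE G H s (A : form (s :: G)) (B : form G) :
    prov T H (Ex s A) -> prov T (A :: map (@fwk s G) H) (fwk s B) -> prov T H B.

Definition proves (T : theory) (A : form []) : Prop := prov T [] A.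

(** * Defined notions *)

(** Equality at higher types is pointwise. *)
Fixpoint Eq (s : ty) : forall G, term G s -> term G s -> form G :=
  match s with
  | N => fun G t u => t =:= u
  | Arr r s => fun G t u =>
      All r (Eq (twk r t $ Var VZ) (twk r u $ Var VZ))
  end.

(** x + y by recursion on y: R y x (fun a n => S a), with [fun a n => S a]
    written as the combinator term Sigma (Pi Pi) S. *)
Definition plus (G : ctx) (x y : term G N) : term G N :=
  Rec N $ y $ x $
    (Sg N N (N ~> N) $ (Pi (N ~> N ~> N) N $ Pi N N) $ Succ).

Definition Le0 (G : ctx) (x y : term G N) : form G :=
  Ex N (plus (twk N x) (Var VZ) =:= twk N y).

(** Strong majorizability; below the two quantifiers v is [VS VZ] and u is
    [VZ]. *)
Fixpoint Maj (s : ty) : forall G, term G s -> term G s -> form G :=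
  match s with
  | N => fun G x y => Le0 x y
  | Arr r s => fun G x y =>
      All r (All r
        (Maj (Var VZ) (Var (VS VZ)) ==>
           Maj (twk r (twk r x) $ Var VZ) (twk r (twk r y) $ Var (VS VZ))
           /&\ Maj (twk r (twk r y) $ Var VZ) (twk r (twk r y) $ Var (VS VZ))))
  end.

Definition Mon (G : ctx) (s : ty) (x : term G s) : form G := Maj x x.

Definition AllSt (G : ctx) (s : ty) (A : form (s :: G)) : form G :=
  All s (St (Var VZ) ==> A).
Definition ExSt (G : ctx) (s : ty) (A : form (s :: G)) : form G :=
  Ex s (St (Var VZ) /&\ A).
Definition AllMon (G : ctx) (s : ty) (A : form (s :: G)) : form G :=
  All s (Mon (Var VZ) ==> A).
Definition ExMon (G : ctx) (s : ty) (A : form (s :: G)) : form G :=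
  Ex s (Mon (Var VZ) /&\ A).
Definition AllMonSt (G : ctx) (s : ty) (A : form (s :: G)) : form G :=
  AllMon (St (Var VZ) ==> A).
Definition ExMonSt (G : ctx) (s : ty) (A : form (s :: G)) : form G :=
  ExMon (St (Var VZ) /&\ A).

(** (exists y <=* t) A(y) *)
Definition ExMaj (G : ctx) (s : ty) (t : term G s) (A : form (s :: G)) :
  form G := Ex s (Maj (Var VZ) (twk s t) /&\ A).

Arguments AllSt {G} s A.
Arguments ExSt {G} s A.
Arguments AllMon {G} s A.
Arguments ExMon {G} s A.
Arguments AllMonSt {G} s A.
Arguments ExMonSt {G} s A.

(** * E-PA^omega *)

(** Congruence of successor, and replacement of equals in internal formulas,
    follow from [epa_ext]. *)
Inductive EPA : theory :=
| epa_refl G (x : term G N) : EPA (x =:= x)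
| epa_sym G (x y : term G N) : EPA (x =:= y ==> y =:= x)
| epa_trans G (x y z : term G N) : EPA (x =:= y ==> y =:= z ==> x =:= z)
| epa_ext G r s (z : term G (r ~> s)) (x y : term G r) :
    EPA (Eq x y ==> Eq (z $ x) (z $ y))
| epa_succ_neq0 G (x : term G N) : EPA (Neg (Succ $ x =:= Zero))
| epa_succ_inj G (x y : term G N) : EPA (Succ $ x =:= Succ $ y ==> x =:= y)
| epa_Pi G r s (x : term G r) (y : term G s) : EPA (Eq (Pi r s $ x $ y) x)
| epa_Sg G r s t (x : term G (r ~> s ~> t)) (y : term G (r ~> s))
    (z : term G r) : EPA (Eq (Sg r s t $ x $ y $ z) (x $ z $ (y $ z)))
| epa_Rec0 G r (y : term G r) (z : term G (r ~> N ~> r)) :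
    EPA (Eq (Rec r $ Zero $ y $ z) y)
| epa_RecS G r (n : term G N) (y : term G r) (z : term G (r ~> N ~> r)) :
    EPA (Eq (Rec r $ (Succ $ n) $ y $ z) (z $ (Rec r $ n $ y $ z) $ n))
| epa_ind G (A : form (N :: G)) :
    internal A ->
    EPA (inst A Zero /&\ All N (A ==> at_succ A) ==> All N A).

(** * E-PA^omega_st *)

Inductive EPAst : theory :=
| epast_epa G (A : form G) : EPA A -> EPAst A
| epast_eq G s (x y : term G s) : EPAst (Eq x y ==> St x ==> St y)
| epast_maj G s (x y : term G s) : EPAst (St y ==> Maj x y ==> St x)
| epast_closed G s (t : term [] s) : EPAst (St (tren (@no_var G) t))
| epast_app G r s (z : term G (r ~> s)) (x : term G r) :
    EPAst (St z ==> St x ==> St (z $ x))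
| epast_ind G (A : form (N :: G)) :
    EPAst (inst A Zero /&\ AllSt N (A ==> at_succ A) ==> AllSt N A).

(** * The system M

    In the choice and realization schemes the formula A = A(x, y) has x as
    [VS VZ] and y as [VZ], besides the parameters in [G]; [under2] weakens A by
    a new variable (f, resp. z) inserted below x and y. *)

Definition under2 (w r s : ty) (G : ctx) (A : form (s :: r :: G)) :
  form (s :: r :: w :: G) := fren (up_ren (up_ren (@shift w G))) A.

Inductive M : theory :=
| m_epast G (A : form G) : EPAst A -> M A
| m_mAC G r s (A : form (s :: r :: G)) :
    internal A ->
    M (AllMonSt r (ExMonSt s A) ==>
       ExMonSt (r ~> s)
         (AllMonSt r (ExMaj (Var (VS VZ) $ Var VZ) (under2 (r ~> s) A))))
| m_R G r s (A : form (s :: r :: G)) :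
    internal A ->
    M (All r (ExSt s A) ==>
       ExMonSt s (All r (ExMaj (Var (VS VZ)) (under2 s A))))
| m_MAJ G r : M (@AllSt G r (ExSt r (Maj (Var (VS VZ)) (Var VZ)))).

(** * Sequences *)

Definition One (G : ctx) : term G N := Succ $ Zero.
Arguments One {G}.

Definition Binary (G : ctx) (a : term G (N ~> N)) : form G :=
  All N (Le0 (twk N a $ Var VZ) One).

Definition BinarySeq (G : ctx) (b : term G (N ~> N ~> N)) : form G :=
  All N (All N (Le0 (twk N (twk N b) $ Var (VS VZ) $ Var VZ) One)).

(** (forall^st n) (exists^st m) (a(n) = m) *)
Definition StdForStd (G : ctx) (a : term G (N ~> N)) : form G :=
  AllSt N (ExSt N (twk N (twk N a) $ Var (VS VZ) =:= Var VZ)).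

Definition Approx1 (G : ctx) (a b : term G (N ~> N)) : form G :=
  AllSt N (twk N a $ Var VZ =:= twk N b $ Var VZ).

(* Main.v *)
Require Import Defs.
From Stdlib Require Import List Morphisms Setoid.
Import ListNotations.

(** Whatever is majorized by a standard object is standard, so each part comes down to
    finding a standard majorant.

    A binary sequence is majorized by the constant function 1, and a binary double
    sequence by the constant function whose value is that function
    ([Maj_const_of_bound]).  Both majorants are closed terms, hence standard.

    Let alpha be standard at standard arguments.  Then for each standard n there is a
    standard m with alpha(n) = m.  Every number is monotone and <=* on numbers is <=, so
    monotone choice yields a standard monotone f with alpha(n) <= f(n) for all standard n
    ([standard_monotone_bound]).  At nonstandard n nothing is known about alpha(n), so
    alpha is cut off: beta(n) = min(alpha(n), f(n)).  For all n whatsoever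
    beta(n) <= f(n), and since f is monotone it follows that beta <=* f ([Maj_trunc]),
    so beta is standard.  At standard n the cut-off changes nothing ([min_eq_l]).

    The rest makes this argument available inside the formal calculus.  Derivable
    equality is a congruence on terms ([eqv]), beta is a combinator term found by bracket
    abstraction ([lam]), and min is defined by recursion and its two properties are proved
    by internal induction ([min_plus], [min_le]). *)

Set Implicit Arguments.
Unset Strict Implicit.
Unset Printing Implicit Defensive.

(** * Substitution *)

(** The induction principle that the indexing of [var] by a context of arbitrary shape
    does not give for nonempty contexts. *)
Definition var_cons_ind (r : ty) (G : ctx) (P : forall s, var (r :: G) s -> Prop)
    (p0 : P r VZ) (pS : forall s (x : var G s), P s (VS x))
    (s : ty) (x : var (r :: G) s) : P s x :=
  match x as x in var D s
    return match D return var D s -> Prop with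
           | [] => fun _ => True
           | r :: G => fun x =>
               forall P : forall s, var (r :: G) s -> Prop,
                 P r VZ -> (forall s (y : var G s), P s (VS y)) -> P s x
           end x
  with
  | VZ => fun P p0 _ => p0
  | VS y => fun P _ pS => pS _ y
  end P p0 pS.

Lemma tsub_ext (G D : ctx) (f g : sub G D) (fg : forall s x, f s x = g s x)
    (s : ty) (t : term G s) : tsub f t = tsub g t.
Proof. induction t; cbn; congruence. Qed.

Lemma tsub_var (G : ctx) (s : ty) (t : term G s) : tsub (fun s x => Var x) t = t.
Proof. induction t; cbn; congruence. Qed.

Lemma tren_tsub (G D : ctx) (f : ren G D) (s : ty) (t : term G s) :
  tren f t = tsub (fun s x => Var (f s x)) t.
Proof. induction t; cbn; congruence. Qed.

Lemma tsub_comp (G D E : ctx) (f : sub D E) (g : sub G D) (s : ty) (t : term G s) :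
  tsub f (tsub g t) = tsub (fun s x => tsub f (g s x)) t.
Proof. induction t; cbn; congruence. Qed.

Lemma tsub_scons_twk (r : ty) (G D : ctx) (u : term D r) (f : sub G D)
    (s : ty) (t : term G s) : tsub (scons u f) (twk r t) = tsub f t.
Proof. unfold twk. rewrite tren_tsub, tsub_comp. reflexivity. Qed.

Lemma tsub_up_twk (r : ty) (G D : ctx) (f : sub G D) (s : ty) (t : term G s) :
  tsub (up_sub (r := r) f) (twk r t) = twk r (tsub f t).
Proof.
  unfold up_sub. rewrite tsub_scons_twk. unfold twk at 2.
  rewrite tren_tsub, tsub_comp. apply tsub_ext. intros. apply tren_tsub.
Qed.

Lemma tsub_shift (r : ty) (G : ctx) (s : ty) (t : term G s) :
  tsub (fun s x => Var (VS (r := r) x)) t = twk r t.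
Proof. symmetry. apply tren_tsub. Qed.

Lemma tren_up_twk (r : ty) (G D : ctx) (f : ren G D) (s : ty) (t : term G s) :
  tren (up_ren (r := r) f) (twk r t) = twk r (tren f t).
Proof. unfold twk. rewrite !tren_tsub, !tsub_comp. reflexivity. Qed.

Lemma fsub_Eq (s : ty) : forall (G D : ctx) (f : sub G D) (t u : term G s),
  fsub f (Eq t u) = Eq (tsub f t) (tsub f u).
Proof.
  induction s as [|r _ s IH]; intros; [reflexivity|].
  cbn. rewrite IH. cbn. rewrite !tsub_up_twk. reflexivity.
Qed.

Lemma fren_Eq (s : ty) : forall (G D : ctx) (f : ren G D) (t u : term G s),
  fren f (Eq t u) = Eq (tren f t) (tren f u).
Proof.
  induction s as [|r _ s IH]; intros; [reflexivity|].
  cbn. rewrite IH. cbn. rewrite !tren_up_twk. reflexivity.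
Qed.

Lemma fsub_Le0 (G D : ctx) (f : sub G D) (t u : term G N) :
  fsub f (Le0 t u) = Le0 (tsub f t) (tsub f u).
Proof. unfold Le0. cbn. rewrite !tsub_up_twk. reflexivity. Qed.

Lemma fren_Le0 (G D : ctx) (f : ren G D) (t u : term G N) :
  fren f (Le0 t u) = Le0 (tren f t) (tren f u).
Proof. unfold Le0. cbn. rewrite !tren_up_twk. reflexivity. Qed.

Lemma fsub_Maj (s : ty) : forall (G D : ctx) (f : sub G D) (t u : term G s),
  fsub f (Maj t u) = Maj (tsub f t) (tsub f u).
Proof.
  induction s as [|r IHr s IHs]; intros; [apply fsub_Le0|].
  cbn. rewrite !IHr, !IHs. cbn. rewrite !tsub_up_twk. reflexivity.
Qed.

Lemma fren_Maj (s : ty) : forall (G D : ctx) (f : ren G D) (t u : term G s),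
  fren f (Maj t u) = Maj (tren f t) (tren f u).
Proof.
  induction s as [|r IHr s IHs]; intros; [apply fren_Le0|].
  cbn. rewrite !IHr, !IHs. cbn. rewrite !tren_up_twk. reflexivity.
Qed.

Lemma twk_App (r : ty) (G : ctx) (s1 s2 : ty) (t : term G (s1 ~> s2)) (u : term G s1) :
  twk r (t $ u) = twk r t $ twk r u.
Proof. reflexivity. Qed.

Lemma tsub_plus (G D : ctx) (f : sub G D) (t u : term G N) :
  tsub f (plus t u) = plus (tsub f t) (tsub f u).
Proof. reflexivity. Qed.

Lemma fren_Mon (G D : ctx) (f : ren G D) (s : ty) (t : term G s) :
  fren f (Mon t) = Mon (tren f t).
Proof. apply fren_Maj. Qed.

Lemma fren_ExMonSt (G D : ctx) (f : ren G D) (s : ty) (A : form (s :: G)) :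
  fren f (ExMonSt s A) = ExMonSt s (fren (up_ren f) A).
Proof. unfold ExMonSt, ExMon. cbn. now rewrite fren_Mon. Qed.

#[local] Hint Rewrite fren_ExMonSt
  tsub_scons_twk tsub_up_twk tsub_var tsub_shift
  tren_up_twk fsub_Eq fren_Eq fsub_Le0 fren_Le0 fsub_Maj fren_Maj
  twk_App tsub_plus : push.

Arguments Eq : simpl never.
Arguments Le0 : simpl never.
Arguments Maj : simpl never.
Arguments plus : simpl never.
Arguments Mon : simpl never.
Arguments twk : simpl never.

(* Moves substitutions and renamings towards the variables, keeping the defined notions
   folded. *)
Ltac push :=
  unfold inst, at_succ, fwk;
  repeat progress
    (cbn [fsub fren tsub tren map scons var_case up_sub up_ren];
     autorewrite with push).

Ltac hyp := apply p_hyp; cbn [In]; tauto.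

(** * Derived rules *)

Lemma prov_weaken (T : theory) (G : ctx) (H : list (form G)) (A : form G) :
  prov T H A -> forall H', incl H H' -> prov T H' A.
Proof.
  induction 1; intros H' HH'.
  - now apply p_ax.
  - apply p_hyp; auto.
  - apply p_raa. apply IHprov. now apply incl_cons; [left|apply incl_tl].
  - apply p_impI. apply IHprov. now apply incl_cons; [left|apply incl_tl].
  - eapply p_impE; eauto.
  - apply p_andI; auto.
  - eapply p_andE1; eauto.
  - eapply p_andE2; eauto.
  - apply p_orI1; auto.
  - apply p_orI2; auto.
  - eapply p_orE; eauto; [apply IHprov2|apply IHprov3];
      now apply incl_cons; [left|apply incl_tl].
  - apply p_allI. apply IHprov. now apply incl_map.
  - apply p_allE; auto.
  - eapply p_exI; eauto.
  - eapply p_exE; eauto. apply IHprov2.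
    apply incl_cons; [now left|]. now apply incl_tl, incl_map.
Qed.

Lemma prov_cut (T : theory) (G : ctx) (H : list (form G)) (A B : form G) :
  prov T H A -> prov T (A :: H) B -> prov T H B.
Proof. intros a b. eapply p_impE; [apply p_impI, b|exact a]. Qed.

Lemma AllSt_elim (T : theory) (G : ctx) (H : list (form G)) (s : ty)
    (A : form (s :: G)) (t : term G s) (B : form G) :
  prov T H (AllSt s A) -> prov T H (St t) -> inst A t = B -> prov T H B.
Proof.
  intros HA Ht <-. eapply p_impE; [|exact Ht]. exact (p_allE t HA).
Qed.

Lemma ExSt_elim (T : theory) (G : ctx) (H : list (form G)) (s : ty)
    (A : form (s :: G)) (C : form G) :
  prov T H (ExSt s A) ->
  prov T (A :: St (Var VZ) :: map (@fwk s G) H) (fwk s C) -> prov T H C.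
Proof.
  intros HA HC. eapply p_exE; [exact HA|].
  eapply prov_cut; [eapply p_andE1; apply p_hyp; now left|].
  eapply prov_cut; [eapply p_andE2; apply p_hyp; right; now left|].
  eapply prov_weaken; [exact HC|]. intros B. cbn. tauto.
Qed.

Lemma ExMonSt_elim (T : theory) (G : ctx) (H : list (form G)) (s : ty)
    (A : form (s :: G)) (C : form G) :
  prov T H (ExMonSt s A) ->
  prov T (A :: St (Var VZ) :: Mon (Var VZ) :: map (@fwk s G) H) (fwk s C) ->
  prov T H C.
Proof.
  intros HA HC. eapply p_exE; [exact HA|].
  eapply prov_cut; [eapply p_andE1; apply p_hyp; now left|].
  eapply prov_cut; [eapply p_andE1, p_andE2; apply p_hyp; right; now left|].
  eapply prov_cut; [eapply p_andE2, p_andE2; apply p_hyp; do 2 right; now left|].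
  eapply prov_weaken; [exact HC|]. intros B. cbn. tauto.
Qed.

Lemma ExMonSt_intro (T : theory) (G : ctx) (H : list (form G)) (s : ty)
    (A : form (s :: G)) (t : term G s) :
  prov T H (Mon t) -> prov T H (St t) -> prov T H (inst A t) ->
  prov T H (ExMonSt s A).
Proof.
  intros Ht St HA. apply p_exI with (t := t). unfold Mon, inst. cbn.
  rewrite fsub_Maj. now repeat apply p_andI.
Qed.

Lemma p_allE_eq (T : theory) (G : ctx) (H : list (form G)) (s : ty)
    (A : form (s :: G)) (t : term G s) (B : form G) :
  prov T H (All s A) -> inst A t = B -> prov T H B.
Proof. intros HA <-. now apply p_allE. Qed.

Lemma epa (G : ctx) (H : list (form G)) (A : form G) : EPA A -> prov M H A.
Proof. intros HA. now apply p_ax, m_epast, epast_epa. Qed.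

Lemma epast (G : ctx) (H : list (form G)) (A : form G) : EPAst A -> prov M H A.
Proof. intros HA. now apply p_ax, m_epast. Qed.

Lemma St_Maj (G : ctx) (H : list (form G)) (s : ty) (x y : term G s) :
  prov M H (St y) -> prov M H (Maj x y) -> prov M H (St x).
Proof.
  intros Y XY. eapply p_impE; [|exact XY]. eapply p_impE; [|exact Y].
  apply epast, epast_maj.
Qed.

Lemma prov_ind_at (G : ctx) (H : list (form G)) (A : form (N :: G)) (t : term G N)
    (B : form G) :
  internal A -> inst A t = B ->
  prov M H (inst A Zero) -> prov M (A :: map (@fwk N G) H) (at_succ A) ->
  prov M H B.
Proof.
  intros HA AB H0 HS. eapply p_allE_eq; [|exact AB].
  eapply p_impE; [now apply epa, epa_ind|].
  apply p_andI; [exact H0|]. now apply p_allI, p_impI.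
Qed.

(** * Equality at all types *)

Lemma Eq_app (G : ctx) (H : list (form G)) (r s : ty) (t u : term G (r ~> s))
    (v : term G r) :
  prov M H (Eq t u) -> prov M H (Eq (t $ v) (u $ v)).
Proof. intros E. eapply p_allE_eq with (t := v); [exact E|]. now push. Qed.

Lemma Eq_refl (s : ty) : forall (G : ctx) (H : list (form G)) (t : term G s),
  prov M H (Eq t t).
Proof.
  induction s; intros; [apply epa, epa_refl|]. apply p_allI, IHs2.
Qed.

Lemma Eq_sym (s : ty) : forall (G : ctx) (H : list (form G)) (t u : term G s),
  prov M H (Eq t u ==> Eq u t).
Proof.
  induction s as [|r _ s IH]; intros; [apply epa, epa_sym|].
  apply p_impI, p_allI.
  eapply p_impE; [apply IH|]. apply Eq_app. push. hyp.
Qed.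

Lemma Eq_trans (s : ty) : forall (G : ctx) (H : list (form G)) (t u v : term G s),
  prov M H (Eq t u ==> Eq u v ==> Eq t v).
Proof.
  induction s as [|r _ s IH]; intros; [apply epa, epa_trans|].
  apply p_impI, p_impI, p_allI.
  eapply p_impE; [eapply p_impE; [apply IH|]|].
  - apply Eq_app with (u := twk r u). push. hyp.
  - apply Eq_app. push. hyp.
Qed.

(** Derivable equality as a relation between terms.  It is a congruence, so that
    equations of the theory can be used for rewriting. *)
Definition eqv (G : ctx) (H : list (form G)) (s : ty) (t u : term G s) : Prop :=
  prov M H (Eq t u).

#[local] Instance eqv_equiv (G : ctx) (H : list (form G)) (s : ty) :
  Equivalence (eqv H (s := s)).
Proof.
  split.
  - intros t. apply Eq_refl.
  - intros t u E. eapply p_impE; [apply Eq_sym|exact E].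
  - intros t u v E F. eapply p_impE; [eapply p_impE; [apply Eq_trans|exact E]|exact F].
Qed.

#[local] Instance eqv_app (G : ctx) (H : list (form G)) (r s : ty) :
  Proper (eqv H (s := r ~> s) ==> eqv H (s := r) ==> eqv H (s := s)) App.
Proof.
  intros t t' E u u' F. transitivity (t $ u').
  - eapply p_impE; [apply epa, epa_ext|exact F].
  - now apply Eq_app.
Qed.

#[local] Instance eqv_plus (G : ctx) (H : list (form G)) :
  Proper (eqv H (s := N) ==> eqv H (s := N) ==> eqv H (s := N)) (@plus G).
Proof. intros t t' E u u' F. unfold plus. now rewrite E, F. Qed.

Lemma eqv_Pi (G : ctx) (H : list (form G)) (r s : ty) (x : term G r) (y : term G s) :
  eqv H (Pi r s $ x $ y) x.
Proof. apply epa, epa_Pi. Qed.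

Lemma eqv_Sg (G : ctx) (H : list (form G)) (r s t : ty) (x : term G (r ~> s ~> t))
    (y : term G (r ~> s)) (z : term G r) :
  eqv H (Sg r s t $ x $ y $ z) (x $ z $ (y $ z)).
Proof. apply epa, epa_Sg. Qed.

Lemma eqv_Rec0 (G : ctx) (H : list (form G)) (r : ty) (y : term G r)
    (z : term G (r ~> N ~> r)) : eqv H (Rec r $ Zero $ y $ z) y.
Proof. apply epa, epa_Rec0. Qed.

Lemma eqv_RecS (G : ctx) (H : list (form G)) (r : ty) (n : term G N) (y : term G r)
    (z : term G (r ~> N ~> r)) :
  eqv H (Rec r $ (Succ $ n) $ y $ z) (z $ (Rec r $ n $ y $ z) $ n).
Proof. apply epa, epa_RecS. Qed.

Ltac to_eqv :=
  match goal with |- prov M ?H (@Eq ?s _ ?t ?u) => change (eqv H (s := s) t u)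
                | |- prov M ?H (?t =:= ?u) => change (eqv H (s := N) t u) end.

(** * Bracket abstraction *)

Fixpoint lam (r : ty) (G : ctx) (s : ty) (t : term (r :: G) s) : term G (r ~> s) :=
  match t with
  | Var x =>
      var_case (P := fun s => term G (r ~> s))
        (Sg r (r ~> r) r $ Pi r (r ~> r) $ Pi r r)
        (fun s y => Pi s r $ Var y) x
  | Zero => Pi N r $ Zero
  | Succ => Pi _ r $ Succ
  | Pi s1 s2 => Pi _ r $ Pi s1 s2
  | Sg s1 s2 s3 => Pi _ r $ Sg s1 s2 s3
  | Rec s => Pi _ r $ Rec s
  | App t u => Sg r _ _ $ lam t $ lam u
  end.

(** Substitution does not commute syntactically with [lam], because the combinator term
    chosen for a variable depends on that term being a variable.  Contracting a
    substituted abstraction as a closure avoids the issue and serves iterated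
    abstractions. *)
Lemma beta_sub (r : ty) (G D : ctx) (H : list (form D)) (f : sub G D) (s : ty)
    (t : term (r :: G) s) (v : term D r) :
  eqv H (tsub f (lam t) $ v) (tsub (scons v f) t).
Proof.
  induction t as [s x| | | | | |s1 s2 t IHt u IHu]; cbn; try apply eqv_Pi.
  - revert s x. apply var_cons_ind; cbn; intros; [|apply eqv_Pi].
    rewrite eqv_Sg. apply eqv_Pi.
  - now rewrite eqv_Sg, IHt, IHu.
Qed.

Lemma tren_lam (r : ty) (G D : ctx) (f : ren G D) (s : ty) (t : term (r :: G) s) :
  tren f (lam t) = lam (tren (up_ren f) t).
Proof.
  induction t as [s x| | | | | |s1 s2 t IHt u IHu]; cbn; try congruence.
  revert s x. now apply var_cons_ind.
Qed.

Lemma beta (r : ty) (G : ctx) (H : list (form G)) (s : ty) (t : term (r :: G) s)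
    (v : term G r) :
  eqv H (lam t $ v) (tsub (scons v (fun s x => Var x)) t).
Proof. rewrite <- (tsub_var (lam t)). apply beta_sub. Qed.

(** * Addition and order *)

Lemma plus0 (G : ctx) (H : list (form G)) (x : term G N) : eqv H (plus x Zero) x.
Proof. apply eqv_Rec0. Qed.

Lemma plusS (G : ctx) (H : list (form G)) (x y : term G N) :
  eqv H (plus x (Succ $ y)) (Succ $ plus x y).
Proof. unfold plus at 1. now rewrite eqv_RecS, eqv_Sg, !eqv_Pi. Qed.

Lemma plus0l (G : ctx) (H : list (form G)) (x : term G N) : eqv H (plus Zero x) x.
Proof.
  apply prov_ind_at with (A := plus Zero (Var VZ) =:= Var VZ) (t := x);
    [exact I|now push|push; apply plus0|push; to_eqv].
  rewrite plusS. apply eqv_app; [reflexivity|hyp].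
Qed.

Lemma plusSl (G : ctx) (H : list (form G)) (x y : term G N) :
  eqv H (plus (Succ $ x) y) (Succ $ plus x y).
Proof.
  apply prov_ind_at with
    (A := plus (Succ $ twk N x) (Var VZ) =:= Succ $ plus (twk N x) (Var VZ)) (t := y);
    [exact I|now push|push; to_eqv|push; to_eqv].
  - now rewrite !plus0.
  - rewrite !plusS. apply eqv_app; [reflexivity|hyp].
Qed.

Lemma plus_assoc (G : ctx) (H : list (form G)) (x y z : term G N) :
  eqv H (plus x (plus y z)) (plus (plus x y) z).
Proof.
  apply prov_ind_at with
    (A := plus (twk N x) (plus (twk N y) (Var VZ)) =:=
          plus (plus (twk N x) (twk N y)) (Var VZ)) (t := z);
    [exact I|now push|push; to_eqv|push; to_eqv].
  - now rewrite !plus0.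
  - rewrite !plusS. apply eqv_app; [reflexivity|hyp].
Qed.

Lemma Le0_plus (G : ctx) (H : list (form G)) (x y z : term G N) :
  eqv H (plus x z) y -> prov M H (Le0 x y).
Proof. intros E. apply p_exI with (t := z). now push. Qed.

Lemma Le0_elim (G : ctx) (H : list (form G)) (x y : term G N) (C : form G) :
  prov M H (Le0 x y) ->
  prov M ((plus (twk N x) (Var VZ) =:= twk N y) :: map (@fwk N G) H) (fwk N C) ->
  prov M H C.
Proof. intros L. now apply p_exE. Qed.

Lemma Le0_eqv (G : ctx) (H : list (form G)) (x y : term G N) :
  eqv H x y -> prov M H (Le0 x y).
Proof. intros E. apply Le0_plus with Zero. now rewrite plus0. Qed.

(** The deduction is made inside the calculus because eliminating the existential
    quantifiers changes the context of free variables; the premises then travel along as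
    hypotheses. *)
Lemma Le0_trans (G : ctx) (H : list (form G)) (x y z : term G N) :
  prov M H (Le0 x y) -> prov M H (Le0 y z) -> prov M H (Le0 x z).
Proof.
  intros E F.
  assert (prov M H (Le0 x y ==> Le0 y z ==> Le0 x z)) as T.
  - apply p_impI, p_impI.
    apply Le0_elim with x y; [hyp|].
    apply Le0_elim with (twk N y) (twk N z); [push; hyp|].
    push. apply Le0_plus with (plus (Var (VS VZ)) (Var VZ)).
    rewrite plus_assoc. transitivity (plus (twk N (twk N y)) (Var VZ));
      [apply eqv_plus; [hyp|reflexivity]|hyp].
  - eapply p_impE; [eapply p_impE; [exact T|exact E]|exact F].
Qed.

(** * The minimum of two numbers *)

(** The step F, n |-> (y |-> R y 0 (fun _ m => S (F m))) of the recursion on x with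
    min 0 y = 0, min (S x) 0 = 0 and min (S x) (S y) = S (min x y). *)
Definition min_step (G : ctx) : term G ((N ~> N) ~> N ~> N ~> N) :=
  lam (lam (lam (Rec N $ Var VZ $ Zero $
    lam (lam (Succ $ (Var (VS (VS (VS (VS VZ)))) $ Var VZ)))))).
Arguments min_step {G}.

Definition min (G : ctx) (x y : term G N) : term G N :=
  Rec (N ~> N) $ x $ (Pi N N $ Zero) $ min_step $ y.
Arguments min : simpl never.

#[local] Instance eqv_min (G : ctx) (H : list (form G)) :
  Proper (eqv H (s := N) ==> eqv H (s := N) ==> eqv H (s := N)) (@min G).
Proof. intros t t' E u u' F. unfold min. now rewrite E, F. Qed.

Lemma tsub_min (G D : ctx) (f : sub G D) (t u : term G N) :
  tsub f (min t u) = min (tsub f t) (tsub f u).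
Proof. reflexivity. Qed.

Lemma tren_min (G D : ctx) (f : ren G D) (t u : term G N) :
  tren f (min t u) = min (tren f t) (tren f u).
Proof. reflexivity. Qed.

#[local] Hint Rewrite tsub_min tren_min : push.

Arguments lam : simpl never.

Lemma min0 (G : ctx) (H : list (form G)) (y : term G N) : eqv H (min Zero y) Zero.
Proof. unfold min. now rewrite eqv_Rec0, eqv_Pi. Qed.

Lemma minS (G : ctx) (H : list (form G)) (x y : term G N) :
  eqv H (min (Succ $ x) y)
    (Rec N $ y $ Zero $
      tsub (scons y (scons x (scons (Rec (N ~> N) $ x $ (Pi N N $ Zero) $ min_step)
             (fun s x => Var x))))
        (lam (lam (Succ $ (Var (VS (VS (VS (VS VZ)))) $ Var VZ))))).
Proof.
  unfold min. rewrite eqv_RecS. unfold min_step at 1.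
  rewrite beta, !beta_sub. cbn. reflexivity.
Qed.

Lemma minS0 (G : ctx) (H : list (form G)) (x : term G N) :
  eqv H (min (Succ $ x) Zero) Zero.
Proof. now rewrite minS, eqv_Rec0. Qed.

Lemma minSS (G : ctx) (H : list (form G)) (x y : term G N) :
  eqv H (min (Succ $ x) (Succ $ y)) (Succ $ min x y).
Proof. rewrite minS, eqv_RecS, !beta_sub. cbn. reflexivity. Qed.

(** Induction on x alone: addition of z on the right shifts along with the successor. *)
Lemma min_plus (G : ctx) (H : list (form G)) (x z : term G N) :
  eqv H (min x (plus x z)) x.
Proof.
  apply prov_ind_at with
    (A := min (Var VZ) (plus (Var VZ) (twk N z)) =:= Var VZ) (t := x);
    [exact I|now push|push; to_eqv|push; to_eqv].
  - apply min0.
  - rewrite plusSl, minSS. apply eqv_app; [reflexivity|hyp].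
Qed.

Lemma Le0_succ (G : ctx) (H : list (form G)) (x y : term G N) :
  prov M H (Le0 x y) -> prov M H (Le0 (Succ $ x) (Succ $ y)).
Proof.
  intros E. eapply p_impE; [|exact E]. apply p_impI.
  apply Le0_elim with x y; [hyp|]. push. apply Le0_plus with (Var VZ).
  rewrite plusSl. apply eqv_app; [reflexivity|hyp].
Qed.

(** Induction on x for all y, as the recursion decreases both arguments. *)
Lemma min_le (G : ctx) (H : list (form G)) (x y : term G N) :
  prov M H (Le0 (min x y) y).
Proof.
  cut (prov M H (All N (Le0 (min (twk N x) (Var VZ)) (Var VZ)))).
  { intros E. eapply p_allE_eq with (t := y); [exact E|now push]. }
  apply prov_ind_at with
    (A := All N (Le0 (min (Var (VS VZ)) (Var VZ)) (Var VZ))) (t := x);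
    [exact I|now push|push|push].
  - apply p_allI. eapply Le0_trans; [apply Le0_eqv, min0|].
    apply Le0_plus with (Var VZ). apply plus0l.
  - apply p_allI.
    (* A case distinction on y, written as an induction; the hypothesis that is used is
       the outer one. *)
    apply prov_ind_at with
      (A := Le0 (min (Succ $ Var (VS (VS VZ))) (Var VZ)) (Var VZ)) (t := Var VZ);
      [exact I|now push|push|push].
    + apply Le0_eqv, minS0.
    + eapply Le0_trans; [apply Le0_eqv, minSS|]. apply Le0_succ.
      eapply p_allE_eq with (t := Var VZ); [hyp|now push].
Qed.

Lemma min_eq_l (G : ctx) (H : list (form G)) (x y : term G N) :
  prov M H (Le0 x y) -> eqv H (min x y) x.
Proof.
  intros E. eapply p_impE; [|exact E]. apply p_impI.
  apply Le0_elim with x y; [hyp|]. push. to_eqv.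
  transitivity (min (twk N x) (plus (twk N x) (Var VZ))); [|apply min_plus].
  apply eqv_min; [reflexivity|]. symmetry. hyp.
Qed.

(** * Majorizability *)

Lemma Maj_app (G : ctx) (H : list (form G)) (r s : ty) (x y : term G (r ~> s))
    (u v : term G r) :
  prov M H (Maj x y) -> prov M H (Maj u v) ->
  prov M H (Maj (x $ u) (y $ v) /&\ Maj (y $ u) (y $ v)).
Proof.
  intros X U. eapply p_impE; [|exact U].
  eapply p_allE_eq with (t := u); [eapply p_allE_eq with (t := v); [exact X|]|].
  - cbn. reflexivity.
  - now push.
Qed.

Lemma Maj_arr (G : ctx) (H : list (form G)) (r s : ty) (x y : term G (r ~> s)) :
  let H' := Maj (Var VZ) (Var (VS VZ)) :: map (@fwk r _) (map (@fwk r G) H) in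
  prov M H' (Maj (twk r (twk r x) $ Var VZ) (twk r (twk r y) $ Var (VS VZ))) ->
  prov M H' (Maj (twk r (twk r y) $ Var VZ) (twk r (twk r y) $ Var (VS VZ))) ->
  prov M H (Maj x y).
Proof. intros H' X Y. apply p_allI, p_allI, p_impI. now apply p_andI. Qed.

Lemma Maj_Eq (s : ty) : forall (G : ctx) (H : list (form G)) (x x' y y' : term G s),
  prov M H (Eq x' x ==> Eq y y' ==> Maj x y ==> Maj x' y').
Proof.
  induction s as [|r _ s IH]; intros G H x x' y y';
    apply p_impI, p_impI, p_impI.
  - eapply Le0_trans; [apply Le0_eqv; hyp|].
    eapply Le0_trans; [|apply Le0_eqv; hyp]. hyp.
  - apply Maj_arr; push.
    + eapply p_impE; [eapply p_impE; [eapply p_impE; [apply IH|]|]|].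
      * apply Eq_app. hyp.
      * apply Eq_app. hyp.
      * eapply p_andE1. apply Maj_app; hyp.
    + (* y u <=* y v is the second half of what x <=* y gives at u <=* v. *)
      eapply p_impE; [eapply p_impE; [eapply p_impE; [apply IH|]|]|].
      * eapply p_impE; [apply Eq_sym|]. apply Eq_app. hyp.
      * apply Eq_app. hyp.
      * eapply p_andE2 with (A := Maj (twk r (twk r x) $ Var VZ) _).
        apply Maj_app; hyp.
Qed.

Lemma Maj_eqv (G : ctx) (H : list (form G)) (s : ty) (x x' y y' : term G s) :
  eqv H x' x -> eqv H y y' -> prov M H (Maj x y) -> prov M H (Maj x' y').
Proof.
  intros E F L. eapply p_impE; [|exact L].
  eapply p_impE; [eapply p_impE; [apply Maj_Eq|exact E]|exact F].
Qed.

(** A uniform monotone bound on all values makes the constant function a majorant.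
    Iterated, this majorizes binary objects of any number of arguments by closed terms. *)
Lemma Maj_const_of_bound (G : ctx) (H : list (form G)) (r s : ty)
    (x : term G (r ~> s)) (c : term G s) :
  prov M H (All r (Maj (twk r x $ Var VZ) (twk r c))) -> prov M H (Mon c) ->
  prov M H (Maj x (Pi s r $ c)).
Proof.
  intros X C. eapply p_impE; [eapply p_impE; [|exact X]|exact C].
  apply p_impI, p_impI, Maj_arr; push.
  - eapply Maj_eqv; [reflexivity|symmetry; apply eqv_Pi|].
    eapply p_allE_eq with (t := Var VZ); [hyp|now push].
  - eapply Maj_eqv; [apply eqv_Pi|symmetry; apply eqv_Pi|]. unfold Mon. push. hyp.
Qed.

Lemma Mon_const (G : ctx) (H : list (form G)) (r s : ty) (c : term G s) :
  prov M H (Mon c) -> prov M H (Mon (Pi s r $ c)).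
Proof.
  intros C. eapply p_impE; [|exact C].
  apply p_impI, Maj_const_of_bound; [|hyp].
  apply p_allI. push. eapply Maj_eqv; [apply eqv_Pi|reflexivity|].
  unfold Mon. push. hyp.
Qed.

(** * Sequences that are standard at standard arguments *)

Definition trunc (G : ctx) (a f : term G (N ~> N)) : term G (N ~> N) :=
  lam (min (twk N a $ Var VZ) (twk N f $ Var VZ)).
Arguments trunc : simpl never.

Lemma eqv_trunc (G : ctx) (H : list (form G)) (a f : term G (N ~> N)) (n : term G N) :
  eqv H (trunc a f $ n) (min (a $ n) (f $ n)).
Proof. unfold trunc. rewrite beta. push. reflexivity. Qed.

Lemma twk_trunc (r : ty) (G : ctx) (a f : term G (N ~> N)) :
  twk r (trunc a f) = trunc (twk r a) (twk r f).
Proof. unfold trunc, twk at 1. rewrite tren_lam. now push. Qed.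
#[local] Hint Rewrite twk_trunc : push.

(** As f is monotone, min (a u) (f u) <= f u <= f v whenever u <= v.  Hence the
    truncation of an arbitrary sequence by a standard monotone one is standard. *)
Lemma Maj_trunc (G : ctx) (H : list (form G)) (a f : term G (N ~> N)) :
  prov M H (Mon f) -> prov M H (Maj (trunc a f) f).
Proof.
  intros E. eapply p_impE; [|exact E]. apply p_impI. unfold Mon.
  apply Maj_arr; push.
  - eapply Le0_trans; [apply Le0_eqv, eqv_trunc|].
    eapply Le0_trans; [apply min_le|].
    eapply p_andE1. apply (Maj_app (r := N) (s := N)); hyp.
  - eapply p_andE1. apply Maj_app; hyp.
Qed.

(** Monotone choice applied to the graph of the sequence: since <=* at type 0 is <=,
    the function f that it supplies bounds the values of the sequence. *)
Lemma standard_monotone_bound (H : list (form [N ~> N])) :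
  prov M H (StdForStd (Var VZ)) ->
  prov M H (ExMonSt (N ~> N) (AllSt N
    (Le0 (Var (VS (VS VZ)) $ Var VZ) (Var (VS VZ) $ Var VZ)))).
Proof.
  intros E.
  eapply prov_cut; [exact E|clear E].
  eapply ExMonSt_elim with (s := N ~> N).
  { (* Choice for the formula alpha x = y, with alpha the free variable below x and y. *)
    eapply p_impE; [apply p_ax, (@m_mAC _ N N
      (Var (VS (VS VZ)) $ Var (VS VZ) =:= Var VZ)); exact I|].
    apply p_allI, p_impI, p_impI.
    eapply ExSt_elim with (s := N).
    - eapply AllSt_elim with (t := Var VZ);
        [apply p_hyp; do 2 right; left; reflexivity|hyp|reflexivity].
    - push. apply ExMonSt_intro with (Var VZ); [now apply Le0_eqv|hyp|cbn; hyp]. }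
  push. apply ExMonSt_intro with (Var VZ); [hyp|hyp|].
  apply p_allI, p_impI. push.
  eapply p_exE with (s := N).
  - eapply p_impE; [eapply p_impE|].
    + eapply p_allE_eq with (t := Var VZ); [hyp|cbn; reflexivity].
    + push. now apply Le0_eqv.
    + hyp.
  - push. eapply Le0_trans; [apply Le0_eqv|eapply p_andE1].
    + eapply p_andE2. apply p_hyp. left. reflexivity.
    + hyp.
Qed.

Theorem theorem1p10 :
  proves M (All (N ~> N) (Binary (Var VZ) ==> St (Var VZ)))
  /\ proves M (All (N ~> N ~> N) (BinarySeq (Var VZ) ==> St (Var VZ)))
  /\ proves M (All (N ~> N)
       (StdForStd (Var VZ) ==>
        ExSt (N ~> N) (Approx1 (Var (VS VZ)) (Var VZ)))).
Proof.
  repeat split.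
  - apply p_allI, p_impI.
    apply St_Maj with (Pi N N $ One); [apply epast, (epast_closed _ (Pi N N $ One))|].
    apply Maj_const_of_bound; [hyp|now apply Le0_eqv].
  - apply p_allI, p_impI.
    apply St_Maj with (Pi _ N $ (Pi N N $ One));
      [apply epast, (epast_closed _ (Pi _ N $ (Pi N N $ One)))|].
    apply Maj_const_of_bound; [|now apply Mon_const, Le0_eqv].
    apply p_allI, Maj_const_of_bound; [|now apply Le0_eqv].
    push. eapply p_allE_eq with (t := Var VZ); [hyp|cbn; reflexivity].
  - apply p_allI, p_impI.
    eapply ExMonSt_elim; [apply standard_monotone_bound; hyp|].
    push. apply p_exI with (t := trunc (Var (VS VZ)) (Var VZ)).
    push. apply p_andI.
    + apply St_Maj with (Var VZ); [hyp|]. apply Maj_trunc. hyp.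
    + apply p_allI, p_impI. push. to_eqv.
      rewrite eqv_trunc. symmetry. apply min_eq_l.
      eapply AllSt_elim; [hyp|hyp|]. now push.
Qed.
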